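(* Let $n\ge 2$ and let $A\in\mathbb{R}^{n\times n}$ be a diagonalizable non-symmetric matrix with eigenvalues $\lambda_1,\lambda_2,\ldots,\lambda_n\in\mathbb{C}$ (listed with multiplicity), ordered so that $\mathrm{Re}(\lambda_1)\ge \mathrm{Re}(\lambda_2)\ge\cdots\ge \mathrm{Re}(\lambda_n)$. Let $E(d,c,a)$ be an ellipse used in the Chebyshev iteration, with real center $d$, foci $d-c$ and $d+c$ ($c\neq 0$), and major semiaxis $a$. If $E(d,c,a)$ contains the undesired eigenvalues $\{\lambda_i\}_{i=2}^n$, then the maximum damping coefficient $\kappa=\max_{2\le i\le n}\left|\frac{w_i}{w_1}\right|$ generated by the Chebyshev iteration satisfies $$\kappa\le \frac{|a|+\sqrt{|a|^2+|c|^2}}{\left|\,|\lambda_1-d|+\sqrt{|\lambda_1-d|^2-|c|^2}\,\right|}.$$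
   Context: Square roots: for $z\in\mathbb{C}$, $\sqrt{z}$ denotes the arithmetic square root, i.e. the square root of $z$ with positive real part, or with zero real part and non-negative imaginary part. In particular $\sqrt{|\lambda_1-d|^2-|c|^2}$ is purely imaginary with positive imaginary part when $|\lambda_1-d|<|c|$, and the outer bars in the denominator denote the complex modulus. Ellipse: $E(d,c,a)$ is an ellipse in the complex plane symmetric with respect to the real axis, with center $d\in\mathbb{R}$, foci $d+c$ and $d-c$, and major semiaxis $a$. The numbers $a$ and $c$ are either both real (major axis on the real axis) or both purely imaginary (major axis parallel to the imaginary axis), and $|a|$ is the length of the major semiaxis, with $|c|<|a|$. ''Contains'' refers to the closed region bounded by the ellipse, i.e. $\{z\in\mathbb{C}: |z-(d+c)|+|z-(d-c)|\le 2|a|\}$. Damping coefficients: the Chebyshev iteration with parameters $d,c,\lambda_1$ applies the polynomial filter $p_m(\lambda)=T_m[(\lambda-d)/c]/T_m[(\lambda_1-d)/c]$, where $T_m(z)=\frac12(w^m+w^{-m})$ with $w$ a root of largest modulus of $\frac12(w+w^{-1})=z$ is the complex Chebyshev polynomial of the first kind of degree $m$. For $i=1,\ldots,n$, $w_i$ denotes a root of largest modulus of the equation $\frac12(w+w^{-1})=\frac{\lambda_i-d}{c}$ in the variable $w$ (the two roots are inverses of each other, so $|w_i|\ge 1$ and $|w_i|$ is well defined). The damping coefficient of $\lambda_i$ is $\kappa_i=\left|\frac{w_i}{w_1}\right|$ for $i=2,\ldots,n$, and the maximum damping coefficient is $\kappa=\max_{2\le i\le n}\kappa_i$. *)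

(* Defs.v *)
From mathcomp Require Import all_boot all_order all_algebra.
From mathcomp Require Import reals.
From mathcomp Require Import complex.

Set Implicit Arguments.
Unset Strict Implicit.
Unset Printing Implicit Defensive.

Import Order.TTheory GRing.Theory Num.Theory.

Local Open Scope ring_scope.
Local Open Scope complex_scope.

(* Throughout, [normc : R[i] -> R] is the R-valued modulus, and
   [sqrtc : R[i] -> R[i]] is the arithmetic square root (positive real part,
   or zero real part and non-negative imaginary part). *)
Notation normc := ComplexField.Normc.normc.

Section Chebyshev.
Variable R : realType.
Implicit Types (d : R) (c a z w v : R[i]).

Definition is_real z : Prop := complex.Im z = 0.
Definition is_imaginary z : Prop := complex.Re z = 0.

(* Parameters (c, a) of an ellipse E(d, c, a) symmetric with respect to the
   real axis. *)
Definition ellipse_params c a : Prop :=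
  (is_real c /\ is_real a \/ is_imaginary c /\ is_imaginary a)
  /\ normc c < normc a.

(* The closed region bounded by E(d, c, a). *)
Definition in_ellipse d c a z : Prop :=
  normc (z - (d%:C + c)) + normc (z - (d%:C - c)) <= 2 * normc a.

(* [w != 0] is needed because [0^-1 = 0] by convention. *)
Definition joukowski_root z w : Prop :=
  w != 0 /\ 2^-1 * (w + w^-1) = z.

Definition largest_joukowski_root z w : Prop :=
  joukowski_root z w /\
  forall v, joukowski_root z v -> normc v <= normc w.

(* Indices are shifted by one: [w`_0] is w_1, ..., [w`_n.-1] is w_n. *)
Definition damping (w : seq R[i]) (i : nat) : R := normc (w`_i / w`_0).

(* The default value 0 is harmless: damping coefficients are non-negative and
   the range is nonempty when 1 < n. *)
Definition max_damping n (w : n.-tuple R[i]) : R :=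
  \big[Num.max/0]_(1 <= i < n) damping w i.

End Chebyshev.

(* Main.v *)
Require Import Defs.
From mathcomp Require Import all_boot all_order all_algebra.
From mathcomp Require Import reals.
From mathcomp Require Import complex.
From mathcomp Require Import ring lra.

Set Implicit Arguments.
Unset Strict Implicit.
Unset Printing Implicit Defensive.

Import Order.TTheory GRing.Theory Num.Theory.

Local Open Scope ring_scope.
Local Open Scope complex_scope.

(** The Joukowski map w |-> (w + 1/w) / 2 sends the circle |w| = r onto the
    ellipse with foci -1 and 1 and sum of focal distances r + 1/r.  Put
    z = (lambda - d) / c; scaling by |c| turns this into: if z is the
    image of w, then x = |c| |w| satisfies x + |c|^2 / x = S, where S is the
    sum of the distances of lambda to the two foci d - c and d + c.  The
    triangle inequality gives 2 |lambda - d| <= S in all cases, and membership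
    in the ellipse gives S <= 2 |a|.

    Both bounds are then read off from quadratic inequalities in x.
    For a damped eigenvalue, x^2 - 2 |a| x + |c|^2 <= 0 puts x below the larger
    root |a| + sqrt(|a|^2 - |c|^2), which is at most the numerator of the
    bound ([quadratic_root_upper]).  For lambda_1, with t = |lambda_1 - d|,
    x^2 - 2 t x + |c|^2 >= 0; as |w_1| >= 1 forces x >= |c|, x lies on the side
    of the larger root t + sqrt(t^2 - |c|^2) if t >= |c|, and if t < |c| the
    denominator is just |t + i sqrt(|c|^2 - t^2)| = |c| <= x
    ([chebyshev_denominator_le]).  Dividing the two bounds, the factor |c|
    cancels in |c| |w_i| / (|c| |w_1|). *)

Section ComplexModulus.
Variable R : realType.
Implicit Types z w : R[i].

Lemma normc_ge0 z : 0 <= normc z.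
Proof. by case: z => x y; exact: sqrtr_ge0. Qed.

Lemma normc_gt0 z : z != 0 -> 0 < normc z.
Proof.
move=> z0; rewrite lt_def normc_ge0 andbT.
by apply: contra z0 => /eqP /ComplexField.Normc.eq0_normc ->.
Qed.

Lemma normc_real (x : R) : normc x%:C = `|x|.
Proof. by rewrite /= expr0n /= addr0 sqrtr_sqr. Qed.

Lemma normc2 : normc (2 : R[i]) = 2.
Proof. by rewrite -(rmorph_nat (real_complex R)) normc_real normr_nat. Qed.

Lemma normc_parallelogram z w :
  normc (z - w) ^+ 2 + normc (z + w) ^+ 2 = 2 * (normc z ^+ 2 + normc w ^+ 2).
Proof.
case: z w => [x y] [u v] /=.
rewrite !sqr_sqrtr ?addr_ge0 ?sqr_ge0 //; ring.
Qed.

End ComplexModulus.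

Section Joukowski.
Variable R : realType.
Implicit Types z w c l : R[i].

Lemma joukowski_rootV z w : joukowski_root z w -> joukowski_root z w^-1.
Proof.
by case=> w0 <-; split; [rewrite invr_eq0 | rewrite invrK addrC].
Qed.

(** The two roots are inverse to each other, so the larger one is not inside
    the unit disc. *)
Lemma largest_joukowski_root_ge1 z w :
  largest_joukowski_root z w -> 1 <= normc w.
Proof.
case=> zw /(_ _ (joukowski_rootV zw)).
case: zw => /normc_gt0 w0 _.
by rewrite ComplexField.Normc.normcV -div1r ler_pdivrMr //; nra.
Qed.

(** Confocal ellipses: z - 1 and z + 1 are (w - 1)^2 / 2w and (w + 1)^2 / 2w,
    so the parallelogram law computes the sum of their moduli. *)
Lemma joukowski_focal_sum z w : joukowski_root z w ->
  normc (z - 1) + normc (z + 1) = normc w + (normc w)^-1.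
Proof.
case=> w0 <-.
have -> : 2^-1 * (w + w^-1) - 1 = (w - 1) ^+ 2 * 2^-1 * w^-1
  by field; rewrite w0.
have -> : 2^-1 * (w + w^-1) + 1 = (w + 1) ^+ 2 * 2^-1 * w^-1
  by field; rewrite w0.
rewrite !ComplexField.Normc.normcM !ComplexField.Normc.normcV normc2 -!expr2.
rewrite -!mulrDl normc_parallelogram ComplexField.Normc.normc1.
by field; rewrite gt_eqF ?normc_gt0.
Qed.

(** The same identity for foci d - c and d + c, multiplied out by |w| so that
    it is quadratic in |c| |w|. *)
Lemma joukowski_focal_sum_scaled (d : R) c l w :
  c != 0 -> joukowski_root ((l - d%:C) / c) w ->
  (normc c * normc w) *
    (normc (l - (d%:C + c)) + normc (l - (d%:C - c)))
  = (normc c * normc w) ^+ 2 + normc c ^+ 2.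
Proof.
move=> c0 zw; have w0 := normc_gt0 (proj1 zw).
have -> : l - (d%:C + c) = c * ((l - d%:C) / c - 1) by field.
have -> : l - (d%:C - c) = c * ((l - d%:C) / c + 1) by field.
rewrite !ComplexField.Normc.normcM -mulrDr (joukowski_focal_sum zw).
by field; rewrite gt_eqF.
Qed.

(** d is the midpoint of the foci. *)
Lemma center_distance_le_focal_sum (d : R) c l :
  2 * normc (l - d%:C) <=
    normc (l - (d%:C + c)) + normc (l - (d%:C - c)).
Proof.
have <- : normc (2 * (l - d%:C)) = 2 * normc (l - d%:C).
  by rewrite ComplexField.Normc.normcM normc2.
have -> : 2 * (l - d%:C) = (l - (d%:C + c)) + (l - (d%:C - c)) by ring.
exact: le_normcD.
Qed.

End Joukowski.

Section Quadratic.
Variable R : realType.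
Implicit Types x t k : R.

(** Completing the square gives x <= t + sqrt(t^2 - k^2); the plus sign under
    the root only weakens this, and matches the numerator of the bound. *)
Lemma quadratic_root_upper x t k :
  x ^+ 2 + k ^+ 2 <= 2 * t * x -> x <= t + Num.sqrt (t ^+ 2 + k ^+ 2).
Proof.
move=> h; rewrite -lerBlDl; apply: le_trans (ler_norm _) _.
rewrite -sqrtr_sqr ler_wsqrtr //; nra.
Qed.

(** The region x^2 - 2tx + k^2 >= 0 has two components when k <= t; their
    endpoints have product k^2, so k <= x selects the upper one. *)
Lemma quadratic_root_lower x t k :
  0 < k -> k <= t -> k <= x -> 2 * t * x <= x ^+ 2 + k ^+ 2 ->
  t + Num.sqrt (t ^+ 2 - k ^+ 2) <= x.
Proof.
move=> k0 kt kx h.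
have s0 := sqrtr_ge0 (t ^+ 2 - k ^+ 2).
have /sqr_sqrtr : 0 <= t ^+ 2 - k ^+ 2 by nra.
move: (Num.sqrt _) s0 => s s0 s2.
rewrite leNgt; apply/negP => xlt.
have xs : x <= t - s.
  by rewrite leNgt; apply/negP => ?; nra.
nra.
Qed.

(** The arithmetic square root of a negative real is purely imaginary, so the
    modulus of the sum collapses to k by Pythagoras. *)
Lemma normc_add_sqrtc_lt t k : 0 <= t -> t < k ->
  normc (t%:C + sqrtc (t ^+ 2 - k ^+ 2)%:C) = k.
Proof.
move=> t0 tk.
have u0 : t ^+ 2 - k ^+ 2 < 0 by nra.
rewrite /= eqxx mul1r expr0n /= addr0 sqrtr_sqr ltr0_norm // addNr mul0r.
rewrite sqrtr0 addr0 add0r sqr_sqrtr; last by rewrite divr_ge0 //; nra.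
have -> : t ^+ 2 + (- (t ^+ 2 - k ^+ 2) - (t ^+ 2 - k ^+ 2)) / 2 = k ^+ 2
  by field.
by rewrite sqrtr_sqr ger0_norm //; lra.
Qed.

Lemma normc_add_sqrtc_ge t k : 0 <= k -> k <= t ->
  normc (t%:C + sqrtc (t ^+ 2 - k ^+ 2)%:C) = t + Num.sqrt (t ^+ 2 - k ^+ 2).
Proof.
move=> k0 kt.
rewrite sqrtc_sqrtr; last by rewrite lecR; nra.
rewrite -rmorphD normc_real ger0_norm // addr_ge0 ?sqrtr_ge0 //; lra.
Qed.

Lemma chebyshev_denominator_le x t k :
  0 < k -> 0 <= t -> k <= x -> 2 * t * x <= x ^+ 2 + k ^+ 2 ->
  normc (t%:C + sqrtc (t ^+ 2 - k ^+ 2)%:C) <= x.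
Proof.
move=> k0 t0 kx h; have [kt|tk] := leP k t.
  by rewrite normc_add_sqrtc_ge ?(ltW k0) // quadratic_root_lower.
by rewrite normc_add_sqrtc_lt.
Qed.

Lemma chebyshev_denominator_gt0 t k : 0 < k -> 0 <= t ->
  0 < normc (t%:C + sqrtc (t ^+ 2 - k ^+ 2)%:C).
Proof.
move=> k0 t0; have [kt|tk] := leP k t; last by rewrite normc_add_sqrtc_lt.
rewrite normc_add_sqrtc_ge ?(ltW k0) // ltr_wpDr ?sqrtr_ge0 //; lra.
Qed.

End Quadratic.

Theorem theorem4p1 (R : realType) (n : nat) (hn : (2 <= n)%N)
  (A : 'M[R]_n)
  (hdiag : diagonalizable (map_mx (real_complex R) A))
  (hnsym : A^T != A)
  (lam : n.-tuple R[i])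
  (hlam : char_poly (map_mx (real_complex R) A)
          = \prod_(x <- lam) ('X - x%:P))
  (hord : forall i j : nat, (i <= j)%N -> (j < n)%N ->
            complex.Re lam`_j <= complex.Re lam`_i)
  (d : R) (c a : R[i])
  (hc : c != 0)
  (hell : ellipse_params c a)
  (hcont : forall i : nat, (1 <= i)%N -> (i < n)%N -> in_ellipse d c a lam`_i)
  (w : n.-tuple R[i])
  (hw : forall i : nat, (i < n)%N ->
          largest_joukowski_root ((lam`_i - d%:C) / c) w`_i) :
  max_damping w <=
    (normc a + Num.sqrt (normc a ^+ 2 + normc c ^+ 2))
    / normc ((normc (lam`_0 - d%:C))%:C
             + sqrtc (normc (lam`_0 - d%:C) ^+ 2 - normc c ^+ 2)%:C).
Proof.
have n0 : (0 < n)%N by apply: leq_trans hn.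
have c0 := normc_gt0 hc.
have t0 := normc_ge0 (lam`_0 - d%:C).
have D0 := chebyshev_denominator_gt0 c0 t0.
have w1 := largest_joukowski_root_ge1 (hw 0 n0).
have D_le : normc ((normc (lam`_0 - d%:C))%:C
    + sqrtc (normc (lam`_0 - d%:C) ^+ 2 - normc c ^+ 2)%:C)
    <= normc c * normc w`_0.
  apply: chebyshev_denominator_le => //; first by nra.
  rewrite -(joukowski_focal_sum_scaled hc (proj1 (hw 0 n0))) mulrC.
  by rewrite ler_pM2l ?center_distance_le_focal_sum //; nra.
have N0 : 0 <= normc a + Num.sqrt (normc a ^+ 2 + normc c ^+ 2).
  by rewrite addr_ge0 ?normc_ge0 ?sqrtr_ge0.
rewrite /max_damping big_seq_cond.
apply: (big_ind (fun x => x <= _)).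
- by rewrite divr_ge0 // ltW.
- by move=> x y hx hy; rewrite ge_max hx.
move=> i; rewrite mem_index_iota andbT => /andP[i1 ilt].
have N_ge : normc c * normc w`_i
    <= normc a + Num.sqrt (normc a ^+ 2 + normc c ^+ 2).
  apply: quadratic_root_upper.
  rewrite -(joukowski_focal_sum_scaled hc (proj1 (hw i ilt))) mulrC.
  rewrite ler_wpM2r ?mulr_ge0 ?normc_ge0 //.
  exact: hcont.
rewrite /damping ComplexField.Normc.normcM ComplexField.Normc.normcV.
(* Clear denominators and multiply by |c|, so that each side is a product of
   the quantities compared in N_ge and D_le. *)
rewrite ler_pdivrMr ?(lt_le_trans ltr01) // mulrAC ler_pdivlMr //.
rewrite -(ler_pM2l c0) mulrA mulrCA.
by rewrite ler_pM ?mulr_ge0 ?normc_ge0.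
Qed.
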